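(* Let $\mathcal C$ be a collection of languages over a countably infinite universe $U$. Then $\mathcal C$ is uniformly noisily generatable if and only if $\mathcal C$ is uniformly generatable without samples. Moreover, $\mathcal C$ is non-uniformly noisily generatable if and only if $\mathcal C$ is generatable in the limit without samples.
   Context: A language is an infinite subset of $U$; a collection is a (possibly uncountable) set of languages. A noisy enumeration of a language $K$ is an infinite sequence $x_0,x_1,\dots$ of pairwise distinct elements of $U$ such that $K\subseteq\bigcup_i\{x_i\}$ and $\bigl|\bigcup_i\{x_i\}\setminus K\bigr|<\infty$; $S_t=\{x_0,\dots,x_t\}$. A generator algorithm is an arbitrary function $G$ from finite sequences of elements of $U$ to $U$, with output $z_t=G(x_0,\dots,x_t)$ at time $t$. $G$ uniformly noisily generates for $\mathcal C$ if there is $t^\star$ such that for every $K\in\mathcal C$, every noisy enumeration $x$ of $K$ and every $t\ge t^\star$, $z_t\in K\setminus S_t$. $G$ non-uniformly noisily generates for $\mathcal C$ if for every $K\in\mathcal C$ there is $t^\star$ such that for every noisy enumeration $x$ of $K$ and every $t\ge t^\star$, $z_t\in K\setminus S_t$. A generator without samples is an injection $G:\mathbb N\to U$ with output $z_t=G(t)$; it uniformly generates without samples for $\mathcal C$ if there is $t^\star$ with $z_t\in K$ for all $K\in\mathcal C$ and all $t\ge t^\star$, and it generates in the limit without samples for $\mathcal C$ if for each $K\in\mathcal C$ there is $t^\star$ with $z_t\in K$ for all $t\ge t^\star$. A collection has one of these properties if some algorithm achieves it. *)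

(* Defs.v *)
From mathcomp Require Import all_boot.
From mathcomp Require Import boolp classical_sets functions cardinality.

Set Implicit Arguments.
Unset Strict Implicit.
Unset Printing Implicit Defensive.

Local Open Scope classical_set_scope.

Definition is_language (U : Type) (K : set U) : Prop := infinite_set K.

Definition is_collection (U : Type) (C : set (set U)) : Prop :=
  forall K, C K -> is_language K.

Definition noisy_enumeration (U : Type) (K : set U) (x : nat -> U) : Prop :=
  [/\ injective x, K `<=` range x & finite_set (range x `\` K)].

(* `I_t.+1 is {0, ..., t}, so this is {x_0, ..., x_t}. *)
Definition samples (U : Type) (x : nat -> U) (t : nat) : set U := x @` `I_t.+1.

(* mkseq x t.+1 is the finite sequence x_0, ..., x_t. *)
Definition output (U : Type) (G : seq U -> U) (x : nat -> U) (t : nat) : U :=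
  G (mkseq x t.+1).

Definition uniformly_noisily_generates (U : Type) (G : seq U -> U)
    (C : set (set U)) : Prop :=
  exists tstar : nat, forall K, C K -> forall x, noisy_enumeration K x ->
    forall t, tstar <= t -> (K `\` samples x t) (output G x t).

Definition nonuniformly_noisily_generates (U : Type) (G : seq U -> U)
    (C : set (set U)) : Prop :=
  forall K, C K -> exists tstar : nat, forall x, noisy_enumeration K x ->
    forall t, tstar <= t -> (K `\` samples x t) (output G x t).

Definition uniformly_generates_without_samples (U : Type) (G : nat -> U)
    (C : set (set U)) : Prop :=
  exists tstar : nat, forall K, C K -> forall t, tstar <= t -> K (G t).

Definition generates_in_the_limit_without_samples (U : Type) (G : nat -> U)
    (C : set (set U)) : Prop :=
  forall K, C K -> exists tstar : nat, forall t, tstar <= t -> K (G t).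

Definition uniformly_noisily_generatable (U : Type) (C : set (set U)) : Prop :=
  exists G : seq U -> U, uniformly_noisily_generates G C.

Definition nonuniformly_noisily_generatable (U : Type) (C : set (set U)) : Prop :=
  exists G : seq U -> U, nonuniformly_noisily_generates G C.

Definition uniformly_generatable_without_samples (U : Type)
    (C : set (set U)) : Prop :=
  exists G : nat -> U, injective G /\ uniformly_generates_without_samples G C.

Definition generatable_in_the_limit_without_samples (U : Type)
    (C : set (set U)) : Prop :=
  exists G : nat -> U, injective G /\ generates_in_the_limit_without_samples G C.

(* Main.v *)
(* From samples to no samples: feed the generator its own outputs, replacing an
   output that has already occurred by an arbitrary fresh element.  Every
   prefix of the resulting injective sequence extends to a noisy enumeration of
   every K in C, so past the threshold of K no replacement takes place and the
   outputs lie in K.  Conversely, given z_0, z_1, ..., answer s with some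
   z_j, j >= size s, that does not occur in s. *)
Require Import Defs.
From mathcomp Require Import all_boot.
From mathcomp Require Import boolp classical_sets functions cardinality.

Local Open Scope classical_set_scope.

(* U carries no eqType structure, so \in is not available; taking u itself as
   the default of nth avoids having to supply one. *)
Definition elements {U : Type} (s : seq U) : set U :=
  [set u | exists2 i, i < size s & nth u s i = u].

Lemma elements_mkseq {U : Type} (x : nat -> U) (n : nat) :
  elements (mkseq x n) = x @` `I_n.
Proof.
apply/seteqP; split=> u /= [i]; rewrite ?size_mkseq => lt_in.
  by rewrite nth_mkseq //; exists i.
by move=> xi; exists i; rewrite ?size_mkseq // nth_mkseq.
Qed.

Lemma finite_elements {U : Type} (s : seq U) : finite_set (elements s).
Proof.
case: s => [|u0 s]; first by rewrite (_ : elements _ = set0) // -subset0 => u [].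
(* The head [u0] serves as default, so the elements form the image of a finite initial segment. *)
rewrite -(mkseq_nth u0 (u0 :: s)) elements_mkseq.
exact/finite_image/finite_II.
Qed.

Lemma infinite_fresh {U : Type} {A : set U} (s : seq U) :
  infinite_set A -> exists2 u, A u & ~ elements s u.
Proof.
move=> Ainf; have [u [Au su]] : A `\` elements s !=set0; last by exists u.
apply: infinite_setN0; exact: infinite_setD Ainf (finite_elements s).
Qed.

Lemma infinite_range {U : Type} {g : nat -> U} :
  injective g -> infinite_set (range g).
Proof.
move=> ginj; rewrite (eq_finite_set (inj_card_eq _)); first exact: infinite_nat.
exact: in2W.
Qed.

(** Iterating [s |-> rcons s (f s)] from [[::]] builds the histories; by induction the [n]-th
    iterate is [mkseq w n]. *)
Lemma exists_history_sequence {U : Type} (f : seq U -> U) :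
  exists w : nat -> U, forall n, w n = f (mkseq w n).
Proof.
pose h n := iter n (fun s => rcons s (f s)) [::].
exists (f \o h) => n /=; congr f.
by elim: n => //= n IHn; rewrite mkseqS -IHn.
Qed.

Lemma countable_enumeration {U : Type} {A : set U} :
  countable A -> infinite_set A -> exists2 e : nat -> U, injective e & range e = A.
Proof.
(* Either [U] is empty, and [A] cannot be infinite, or [U] has a point. *)
elim/Ppointed: U => U in A *; first by rewrite emptyE.
move=> Acount Ainf.
have /card_esym/card_set_bijP[e [efun einj esurj]] := eq_card_nat Acount Ainf.
exists e; first by move=> i j; apply: einj; rewrite inE.
by apply/seteqP; split=> // _ [i _ <-]; exact: efun.
Qed.

(** Follow [w] for [n] steps, then enumerate what is left of [K]: all noise lies among the first [n]
    values of [w]. *)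
Lemma prefix_noisy_enumeration {U : Type} {K : set U} {w : nat -> U} (n : nat) :
  countable K -> infinite_set K -> injective w ->
  exists2 x, noisy_enumeration K x & mkseq x n = mkseq w n.
Proof.
move=> Kcount Kinf winj; pose S := w @` `I_n.
have Sfin : finite_set S by exact/finite_image/finite_II.
have KScount : countable (K `\` S).
  exact: sub_countable (subset_card_le (@subDsetl _ K S)) Kcount.
have [e einj eE] := countable_enumeration KScount (infinite_setD Kinf Sfin).
have eS i k : i < n -> w i <> e k.
  by move=> lt_in wi; have : range e (w i) by [exists k]; rewrite eE => -[_]; apply; exists i.
pose x i := if i < n then w i else e (i - n).
exists x; last first.
  apply: (@eq_from_nth _ (w 0)); rewrite !size_mkseq // => i lt_in.
  by rewrite !nth_mkseq // /x lt_in.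
split.
- move=> i j; rewrite /x; case: ltnP => [lt_in|le_ni]; case: ltnP => [lt_jn|le_nj].
  + exact: winj.
  + by move/eS => /(_ lt_in).
  + by move/esym/eS => /(_ lt_jn).
  + by move=> /einj /(congr1 (addn n)); rewrite !subnKC.
- move=> u Ku; have [[i lt_in <-]|nSu] := pselect (S u); first by exists i; rewrite // /x lt_in.
  have [k _ <-] : range e u by rewrite eE.
  by exists (n + k); rewrite // /x ltnNge leq_addr addKn.
- apply: sub_finite_set Sfin => _ [[i _ <-]]; rewrite /x; case: ltnP => [lt_in _|_ nKe].
    by exists i.
  have : range e (e (i - n)) by exists (i - n).
  by rewrite eE => -[].
Qed.

(** The sequence [w] is chosen before [K] and [tstar], so one statement serves both the uniform and
    the non-uniform case. *)
Lemma noisy_to_sampleless {U : Type} (C : set (set U)) (G : seq U -> U) :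
    countable [set: U] -> infinite_set [set: U] -> is_collection C ->
  exists2 w : nat -> U, injective w &
    forall K tstar, C K ->
      (forall x, noisy_enumeration K x ->
         forall t, tstar <= t -> (K `\` samples x t) (output G x t)) ->
      forall t, tstar.+1 <= t -> K (w t).
Proof.
move=> Ucount Uinf Clang.
have /choice[f fP] : forall s, exists u,
    ~ elements s u /\ (~ elements s (G s) -> u = G s).
  move=> s; have [sG|nsG] := pselect (elements s (G s)); last by exists (G s).
  by have [u _ su] := infinite_fresh s Uinf; exists u; split.
have [w wE] := exists_history_sequence f.
have w_neq i n : i < n -> w i <> w n.
  move=> lt_in eq_w; have [+ _] := fP (mkseq w n).
  by rewrite -wE elements_mkseq; apply; exists i.
have winj : injective w.
  by move=> i j eq_w; case: (ltngtP i j) => // /w_neq; rewrite eq_w.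
(* The shift by one: [w t.+1] is computed from [w 0, ..., w t], the data behind an output at time
   [t]. *)
exists w => // K tstar CK Gok [//|t] tstar_t.
have Kcount : countable K by apply: sub_countable Ucount; exact: subset_card_le.
have [x xK eqx] := prefix_noisy_enumeration t.+1 Kcount (Clang _ CK) winj.
have [] := Gok x xK t tstar_t.
(* Correctness of [G] on [x] makes its output fresh, so [f] keeps it. *)
rewrite /output /samples -elements_mkseq eqx => KG /(fP _).2 fG.
by rewrite wE fG.
Qed.

Lemma sampleless_to_noisy {U : Type} {g : nat -> U} : injective g ->
  exists G : seq U -> U, forall (K : set U) tstar,
    (forall t, tstar <= t -> K (g t)) ->
    forall x t, tstar <= t -> (K `\` samples x t) (output G x t).
Proof.
move=> ginj.
have /choice[G GP] : forall s, exists u,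
    (exists2 j, size s <= j & g j = u) /\ ~ elements s u.
  (* The tail of [g] from [size s] on has infinite range, so it leaves the finite set
     [elements s]. *)
  move=> s; pose h i := g (size s + i).
  have hinj : injective h by move=> i j /ginj /addnI.
  have [_ [i _ <-] su] := infinite_fresh s (infinite_range hinj).
  by exists (h i); split=> //; exists (size s + i); rewrite ?leq_addr.
exists G => K tstar Kg x t tstar_t; rewrite /samples -elements_mkseq /output.
(* The history at time [t] has size [t.+1], hence [j > t >= tstar]. *)
have [[j]] := GP (mkseq x t.+1); rewrite size_mkseq => lt_tj <- nsg.
by split=> //; apply: Kg; rewrite (leq_trans tstar_t) // ltnW.
Qed.

Theorem theorem1p2 (U : Type) (U_countable : countable [set: U])
    (U_infinite : infinite_set [set: U])
    (C : set (set U)) (C_collection : is_collection C) :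
  (uniformly_noisily_generatable C <->
     uniformly_generatable_without_samples C) /\
  (nonuniformly_noisily_generatable C <->
     generatable_in_the_limit_without_samples C).
Proof.
split; split.
- move=> [G [tstar Gok]].
  have [w winj wok] := noisy_to_sampleless C G U_countable U_infinite C_collection.
  by exists w; split=> //; exists tstar.+1 => K CK; apply: wok => // x; apply: Gok.
- move=> [g [ginj [tstar gok]]]; have [G Gok] := sampleless_to_noisy ginj.
  by exists G, tstar => K CK x _; apply: Gok; apply: gok.
- move=> [G Gok].
  have [w winj wok] := noisy_to_sampleless C G U_countable U_infinite C_collection.
  exists w; split=> // K CK; have [tstar Gt] := Gok K CK.
  by exists tstar.+1; apply: wok.
- move=> [g [ginj gok]]; have [G Gok] := sampleless_to_noisy ginj.
  exists G => K CK; have [tstar gt] := gok K CK.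
  by exists tstar => x _; apply: Gok.
Qed.
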